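(* If $P_i$ is the normal distribution $N(\mu_i,\sigma_i^2)$ with mean $\mu_i\in\mathbb{R}$ and variance $\sigma_i^2>0$, for $i=1,\dots,n$, then $$\&(P_1,\dots,P_n)=N\left(\frac{\sum_{i=1}^n\frac{\mu_i}{\sigma_i^2}}{\sum_{i=1}^n\frac{1}{\sigma_i^2}},\ \frac{1}{\sum_{i=1}^n\sigma_i^{-2}}\right).$$
   Context: $\delta_x$ is the Dirac measure at $x$, and $\|m\|$ is the total mass of a Borel sub-probability measure $m$. For Borel probability measures $P_1,\dots,P_n$ on $\mathbb{R}$ and $j\in\mathbb{N}$, define the sub-probability measure $$m_j(P_1,\dots,P_n)=\sum_{k\in\mathbb{Z}}\ \prod_{i=1}^n P_i\big(((k-1)2^{-j},k2^{-j}]\big)\,\delta_{k2^{-j}}.$$ If $m_j(P_1,\dots,P_n)/\|m_j(P_1,\dots,P_n)\|$ converges vaguely, as $j\to\infty$, to a Borel probability measure $Q$, then $Q$ is called the conflation of $P_1,\dots,P_n$ and is written $\&(P_1,\dots,P_n)$. Vague convergence $\nu_j\to\nu$ of sub-probability measures means $\int f\,d\nu_j\to\int f\,d\nu$ for all continuous $f$ vanishing at infinity. *)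

(* Defs.v *)
From HB Require Import structures.
From mathcomp Require Export all_boot all_order all_algebra.
From mathcomp Require Export all_classical all_reals all_analysis.

Set Implicit Arguments.
Unset Strict Implicit.
Unset Printing Implicit Defensive.

Import Order.TTheory GRing.Theory Num.Theory.
Import numFieldNormedType.Exports.

Local Open Scope classical_set_scope.
Local Open Scope ring_scope.
Local Open Scope ereal_scope.

Definition dyadic {R : realType} (j : nat) (k : int) : R :=
  (k%:~R / 2 ^+ j)%R.

Definition dyadic_cell {R : realType} (j : nat) (k : int) : set R :=
  `]dyadic j (k - 1), dyadic j k]%classic.

Lemma measurable_dyadic_cell {R : realType} (j : nat) (k : int) :
  measurable (dyadic_cell j k : set (measurableTypeR R)).
Proof. exact: measurable_itv. Qed.

Lemma trivIset_dyadic_cell {R : realType} (j : nat) (D : set int) :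
  trivIset D (@dyadic_cell R j).
Proof.
have le_dyadic (a b : int) : (@dyadic R j a < dyadic j b)%R = (a < b)%R.
  by rewrite /dyadic ltr_pM2r ?invr_gt0 ?exprn_gt0// ltr_int.
have half (a b : int) (x : R) : dyadic_cell j a x -> dyadic_cell j b x ->
    (a <= b)%R.
  rewrite /dyadic_cell /= !in_itv /= => /andP[ax _] /andP[_ xb].
  by have := lt_le_trans ax xb; rewrite le_dyadic ltrBlDr ltzD1.
by move=> a b _ _ [x [xa xb]]; apply/eqP; rewrite eq_le !(half _ _ x).
Qed.

(* The measure m_j of a family P, kept as a bare measure so that it makes sense
   for n = 0 as well; it is a sub-probability as soon as 0 < n *)
Section dyadic_product.
Context {R : realType} {n : nat}.
Variables (P : 'I_n -> probability (measurableTypeR R) R) (j : nat).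

Definition dyadic_weight (k : int) : \bar R :=
  \prod_(i < n) P i (dyadic_cell j k).

Definition dyadic_product (A : set (measurableTypeR R)) : \bar R :=
  \esum_(k in [set: int])
    (dyadic_weight k * \d_(dyadic j k : measurableTypeR R) A).

Lemma dyadic_weight_ge0 k : 0 <= dyadic_weight k.
Proof. by apply: prode_ge0 => i _; exact: measure_ge0. Qed.

Lemma dyadic_weight_fin_num k : dyadic_weight k \is a fin_num.
Proof.
apply: prode_fin_num => i _; apply: fin_num_measure.
exact: measurable_dyadic_cell.
Qed.

Let dyadic_product0 : dyadic_product set0 = 0.
Proof. by rewrite /dyadic_product esum1// => k _; rewrite measure0 mule0. Qed.

Let dyadic_product_ge0 A : 0 <= dyadic_product A.
Proof. by apply: esum_ge0 => k _; rewrite mule_ge0// dyadic_weight_ge0. Qed.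

Let dyadic_product_sigma_additive : semi_sigma_additive dyadic_product.
Proof.
move=> F mF tF mUF.
have ge0 k i : 0 <= dyadic_weight k * \d_(dyadic j k : measurableTypeR R) (F i).
  by rewrite mule_ge0// dyadic_weight_ge0.
suff -> : dyadic_product (\bigcup_i F i) = \sum_(i <oo) dyadic_product (F i).
  by apply: is_cvg_ereal_nneg_natsum => i _; exact: dyadic_product_ge0.
rewrite nneseries_esumT//.
transitivity (\esum_(k in [set: int]) \esum_(i in [set: nat])
    (dyadic_weight k * \d_(dyadic j k : measurableTypeR R) (F i))).
  apply: eq_esum => k _; rewrite measure_semi_bigcup//.
  rewrite -nneseries_esumT//; rewrite -(fineK (dyadic_weight_fin_num k)).
  by rewrite nneseriesZl.
rewrite esum_esum// [RHS]esum_esum//.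
rewrite (reindex_esum ([set: nat] `*`` fun=> [set: int]) _ (fun x => (x.2, x.1)))//.
by split=> [[a b]//|[a b] [c d] _ _ [-> ->]//|[a b] _]; exists (b, a).
Qed.

HB.instance Definition _ := isMeasure.Build _ _ _ dyadic_product
  dyadic_product0 dyadic_product_ge0 dyadic_product_sigma_additive.

Lemma dyadic_product_setT_le1 : (0 < n)%N -> dyadic_product setT <= 1.
Proof.
move=> n0; pose i0 : 'I_n := Ordinal n0.
have weight_le k : dyadic_weight k <= P i0 (dyadic_cell j k).
  rewrite /dyadic_weight (bigD1 i0)//= -[leRHS]mule1; apply: lee_wpmul2l => //.
  suff /andP[] : 0 <= \prod_(i < n | i != i0) P i (dyadic_cell j k) <= 1 by [].
  elim/big_ind : _ => [|x y /andP[x0 x1] /andP[y0 y1]|i _].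
  - by rewrite lee01 lexx.
  - by rewrite mule_ge0//= -[leRHS]mule1 lee_pmul.
  - by rewrite measure_ge0 probability_le1//; exact: measurable_dyadic_cell.
rewrite ge_ereal_sup// => _ [X [finX _] <-].
rewrite (@le_trans _ _ (\sum_(k \in X) P i0 (dyadic_cell j k)))//.
  by apply: lee_fsum => // k _; rewrite diracT mule1.
rewrite -measure_fin_bigcup//; last 2 first.
- exact: trivIset_dyadic_cell.
- by move=> k _; exact: measurable_dyadic_cell.
apply: probability_le1; apply: fin_bigcup_measurable => // k _.
exact: measurable_dyadic_cell.
Qed.

End dyadic_product.

Section normalize.
Context d (T : measurableType d) (R : realType).
Variable m : {measure set T -> \bar R}.

Lemma mass_inv_ge0 : (0 <= (fine (m setT))^-1)%R.
Proof. by rewrite invr_ge0 fine_ge0. Qed.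

(* m / ||m||, which is the zero measure if the mass ||m|| is 0 or infinite *)
Definition normalize : set T -> \bar R := mscale (NngNum mass_inv_ge0) m.

HB.instance Definition _ := Measure.on normalize.

Let normalize_setT : normalize setT <= 1.
Proof.
rewrite /normalize /mscale/=.
have [mfin|minf] := boolP (m setT \is a fin_num); last first.
  by have /eqP -> : m setT == +oo; rewrite ?invr0 ?mul0e//; rewrite ge0_fin_numE// -leNgt leye_eq in minf.
rewrite -{2}(fineK mfin) -EFinM lee_fin.
have [->|m0] := eqVneq (fine (m setT)) 0%R; first by rewrite mulr0.
by rewrite mulVf.
Qed.

HB.instance Definition _ := Measure_isSubProbability.Build _ _ _ normalize
  normalize_setT.

End normalize.

Definition vanishing_at_infinity {R : realType} (f : R -> R) : Prop :=
  (f x @[x --> +oo%R] --> 0%R) /\ (f x @[x --> -oo%R] --> 0%R).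

Definition vague_cvg {R : realType}
    (nu_ : nat -> subprobability (measurableTypeR R) R)
    (nu : subprobability (measurableTypeR R) R) : Prop :=
  forall f : R -> R, continuous f -> vanishing_at_infinity f ->
    \int[nu_ j]_x (f x)%:E @[j --> \oo] --> \int[nu]_x (f x)%:E.

(* Q is the conflation &(P_1, ..., P_n). Since Q has mass 1, the convergence
   cannot hold if the mass of dyadic_product P j is 0 for infinitely many j, so
   the convention made in normalize for null measures plays no role. *)
Definition is_conflation {R : realType} {n : nat}
    (P : 'I_n -> probability (measurableTypeR R) R)
    (Q : probability (measurableTypeR R) R) : Prop :=
  vague_cvg (fun j => normalize (dyadic_product P j)) Q.

(* N(m, v); the second parameter of normal_prob is the standard deviation *)
Definition normal_law {R : realType} (m v : R) :
    probability (measurableTypeR R) R :=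
  normal_prob m (Num.sqrt v).

(* Main.v *)
Require Import Defs.
From mathcomp Require Import measurable_realfun ring lra.

(** Write [m_j] for [dyadic_product P j], and let [p i] be the density of [P i].
    The mass of a dyadic cell of scale [j] under [P i] is [2^-j] times the mean
    of [p i] over this cell. Hence, up to the factor [2^j / 2^(jn)], the
    integral of [f] against [m_j] is the Lebesgue integral of the step function
    whose value at [x] is the product of these means over the cell containing
    [x], times the value of [f] at the right endpoint of that cell
    ([integral_dyadic_product]). By continuity of [f] and of the densities the
    step functions converge pointwise to [f x * \prod_i p i x]
    ([cvg_prod_cell_density]), and they are dominated as soon as the densities
    are bounded and one of them has an integrable envelope at unit scale
    ([prod_cell_density_le]), so their integrals converge
    ([cvg_integral_cell_density]). Dividing by the total mass, which is the
    case [f = 1], cancels the factor, and the limit is the integral of [f]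
    against the normalized product of the densities ([conflation_density]).

    For normal distributions, a normal density with twice the variance provides
    the envelope ([normal_pdf_le_near]), and completing the square identifies
    the normalized product of the densities ([prod_normal_pdf]). *)

Set Implicit Arguments.
Unset Strict Implicit.
Unset Printing Implicit Defensive.

Import Order.TTheory GRing.Theory Num.Theory.
Import numFieldNormedType.Exports.

Local Open Scope classical_set_scope.
Local Open Scope ring_scope.

(** * Integration against a measure with a density *)

Section density.
Local Open Scope ereal_scope.
Context d (T : measurableType d) (R : realType).
Variables (m mu : {measure set T -> \bar R}) (h : T -> R).
Hypothesis h_ge0 : forall x, (0 <= h x)%R.
Hypothesis mh : measurable_fun setT h.
Hypothesis mE : forall A, measurable A -> m A = \int[mu]_(x in A) (h x)%:E.

Import HBNNSimple.

(* For simple functions, mE applies to each level set. *)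
Let integral_density_nnsfun (g : {nnsfun T >-> R}) :
  \int[m]_x (g x)%:E = \int[mu]_x ((g x)%:E * (h x)%:E).
Proof.
under [LHS]eq_integral do rewrite fimfunE -fsumEFin//.
rewrite [LHS]ge0_integral_fsum//; last 2 first.
  - by move=> r; exact/measurable_EFinP/measurableT_comp.
  - by move=> n x _; rewrite EFinM nnfun_muleindic_ge0.
under [RHS]eq_integral.
  move=> x xD; rewrite muleC fimfunE -fsumEFin// ge0_mule_fsumr; last first.
    by move=> r; rewrite EFinM nnfun_muleindic_ge0.
  over.
rewrite [RHS]ge0_integral_fsum//; last 2 first.
  - move=> r; apply: emeasurable_funM; first exact/measurable_EFinP.
    exact/measurable_EFinP/measurableT_comp.
  - by move=> n x _; rewrite EFinM mule_ge0// ?nnfun_muleindic_ge0 ?lee_fin.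
apply: eq_fsbigr => r _.
have [r0|r0] := ltP r 0%R.
  rewrite !integral0_eq// => x _.
    by rewrite preimage_nnfun0// indic0 mulr0 mule0.
  by rewrite preimage_nnfun0// indic0 mulr0.
rewrite integralZl_indic_nnsfun// integral_indic// setIT mE//.
under [RHS]eq_integral => x _ do rewrite EFinM muleCA.
rewrite ge0_integralZl//; last 2 first.
  - apply: emeasurable_funM; first exact/measurable_EFinP.
    exact/measurable_EFinP.
  - by move=> x _; rewrite mule_ge0 ?lee_fin.
congr (_ * _); rewrite integral_mkcond; apply: eq_integral => x _.
by rewrite epatch_indic.
Qed.

(** Integration against a measure [m] with density [h] with respect to [mu]:
    the nonnegative case, by monotone approximation with simple functions. *)
Lemma ge0_integral_density (f : T -> \bar R) : measurable_fun setT f ->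
  (forall x, 0 <= f x) -> \int[m]_x f x = \int[mu]_x (f x * (h x)%:E).
Proof.
move=> mf f0; pose f_ := nnsfun_approx measurableT mf.
have f_f x : EFin \o f_^~ x @ \oo --> f x by exact: cvg_nnsfun_approx.
have nd_f x : {homo f_^~ x : a b / (a <= b)%N >-> (a <= b)%R}.
  by move=> a b ab; exact/lefP/nd_nnsfun_approx.
transitivity (limn (fun n => \int[m]_x (f_ n x)%:E)).
  rewrite -monotone_convergence//=.
  - by apply: eq_integral => x _; apply/esym/cvg_lim => //=; exact: f_f.
  - by move=> n; exact/measurable_EFinP/measurable_funTS.
  - by move=> n x _; rewrite lee_fin.
  - by move=> x _ a b ab; rewrite lee_fin; exact: nd_f.
under eq_fun do rewrite integral_density_nnsfun.
rewrite -monotone_convergence//=.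
- apply: eq_integral => x _; apply/cvg_lim => //.
  by under eq_fun do rewrite muleC; rewrite muleC; apply: cvgeZl => //; exact: f_f.
- move=> n; apply: emeasurable_funM; exact/measurable_EFinP.
- by move=> n x _; rewrite mule_ge0// lee_fin.
- by move=> x _ a b ab; rewrite lee_wpmul2r ?lee_fin//; exact: nd_f.
Qed.

End density.

(** * Dyadic cells of the real line *)

Section cells.
Context {R : realType}.
Implicit Types (j : nat) (k : int) (x : R).

(** The index of the dyadic cell of scale [j] that contains [x]; the cells are
    open on the left and closed on the right, whence the ceiling. *)
Definition cell_index j x : int := Num.ceil (x * 2 ^+ j).

Lemma dyadic_cellP j k x : dyadic_cell j k x <-> cell_index j x = k.
Proof.
have j0 : 0 < (2 : R) ^+ j by rewrite exprn_gt0.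
rewrite /dyadic_cell /dyadic /= in_itv /= ltr_pdivrMr// ler_pdivlMr//.
by rewrite -ceil_eq; split => /eqP.
Qed.

Lemma mem_dyadic_cell j x : dyadic_cell j (cell_index j x) x.
Proof. exact/dyadic_cellP. Qed.

Lemma dyadicB j k : dyadic j k - dyadic j (k - 1) = (2 ^+ j)^-1 :> R.
Proof. by rewrite /dyadic -mulrBl -intrB opprB addrCA subrr addr0 mul1r. Qed.

Lemma dyadic_mem_cell j k : dyadic_cell j k (dyadic j k : R).
Proof.
rewrite /dyadic_cell /= in_itv /= lexx andbT -subr_gt0 dyadicB.
by rewrite invr_gt0 exprn_gt0.
Qed.

Lemma dyadic_cell_dist j k (x y : R) : dyadic_cell j k x -> dyadic_cell j k y ->
  `|x - y| <= (2 ^+ j)^-1.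
Proof.
rewrite /dyadic_cell /= !in_itv /= -(dyadicB j k) ler_norml.
by move=> /andP[? ?] /andP[? ?]; lra.
Qed.

Lemma lebesgue_measure_dyadic_cell j k :
  lebesgue_measure (dyadic_cell j k : set R) = ((2 ^+ j)^-1)%:E.
Proof.
rewrite /dyadic_cell lebesgue_measure_itv /= lte_fin -subr_gt0 dyadicB.
by rewrite invr_gt0 exprn_gt0// -EFinB dyadicB.
Qed.

Lemma bigcup_dyadic_cell j : \bigcup_k dyadic_cell j k = [set: R].
Proof.
by apply/seteqP; split => // x _; exists (cell_index j x) => //; exact: mem_dyadic_cell.
Qed.

(** A function that is constant on each dyadic cell of scale [j] is
    measurable. *)
Lemma measurable_fun_cell_index j (phi : int -> R) :
  measurable_fun setT (phi \o cell_index j).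
Proof.
move=> _ B mB; rewrite setTI.
rewrite (_ : _ @^-1` _ = \bigcup_k (if phi k \in B then dyadic_cell j k else set0)).
  apply: countable_bigcupT_measurable => // k.
  by case: ifP => // _; exact: measurable_dyadic_cell.
apply/seteqP; split => [x /= Bx|x [k _]].
  by exists (cell_index j x) => //; rewrite mem_set//; exact: mem_dyadic_cell.
case: ifP => // /set_mem Bk /dyadic_cellP xk.
by rewrite /preimage /= xk.
Qed.

Lemma ex_bijective_nat_int : exists e : nat -> int, bijective e.
Proof.
exists (fun n => if odd n then Negz n./2 else Posz n./2).
exists (fun k => match k with Posz n => n.*2 | Negz n => n.*2.+1 end).
  move=> n; rewrite -[RHS](odd_double_half n).
  by case: ifP.
by case=> n /=; rewrite odd_double/= ?doubleK ?uphalf_double.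
Qed.

(** Countable additivity of the integral over the dyadic cells of scale [j],
    for an arbitrary measure. *)
Lemma ge0_integral_dyadic_cell (m : {measure set (measurableTypeR R) -> \bar R}) j
    (f : R -> \bar R) : measurable_fun setT f -> (forall x, 0 <= f x)%E ->
  (\int[m]_x f x = \esum_(k in [set: int]) \int[m]_(x in dyadic_cell j k) f x)%E.
Proof.
move=> mf f0; have [e] := ex_bijective_nat_int; rewrite -setTT_bijective => e_bij.
have [_ e_inj e_surj] := e_bij.
have UE : \bigcup_n (dyadic_cell j (e n) : set R) = setT.
  rewrite -(bigcup_dyadic_cell j); apply/seteqP; split => [x [n _ ?]|x [k _ kx]].
    by exists (e n).
  by have [n _ nk] := e_surj k I; exists n => //; rewrite nk.
rewrite (@reindex_esum _ _ _ _ _ e _ e_bij) -nneseries_esumT; last first.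
  by move=> n; apply: integral_ge0.
rewrite -[in LHS]UE ge0_integral_bigcup//.
- by move=> n; exact: measurable_dyadic_cell.
- by rewrite UE.
- move=> a b _ _ /(@trivIset_dyadic_cell R j setT (e a) (e b) I I).
  by move/e_inj => ->//; rewrite inE.
Qed.

End cells.

(** * The discretized product as a Lebesgue integral *)

Section discretization.
Context {R : realType} {n : nat}.
Variable P : 'I_n -> probability (measurableTypeR R) R.
Implicit Types (i : 'I_n) (j : nat) (k : int) (x : R).

(** The mean of the density of [P i] over the dyadic cell of scale [j]
    containing [x], that is, the mass of that cell divided by its length. *)
Definition cell_density i j x : R :=
  2 ^+ j * fine (P i (dyadic_cell j (cell_index j x))).

Lemma cell_density_ge0 i j x : 0 <= cell_density i j x.
Proof. by rewrite mulr_ge0 ?exprn_ge0// fine_ge0. Qed.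

Lemma measurable_cell_density i j : measurable_fun setT (cell_density i j).
Proof.
exact: (measurable_fun_cell_index j
  (fun k => 2 ^+ j * fine (P i (dyadic_cell j k)))).
Qed.

(** Inside the cell of index [k], the measure [dyadic_product P j] is a single
    atom, at the right endpoint of the cell. *)
Lemma dyadic_product_subcell j k (A : set (measurableTypeR R)) :
  A `<=` dyadic_cell j k ->
  (dyadic_product P j A =
    dyadic_weight P j k * \d_(dyadic j k : measurableTypeR R) A)%E.
Proof.
move=> Ak; rewrite /dyadic_product -(esum_set1 (t := k)
  (a := fun k => dyadic_weight P j k * \d_(dyadic j k : measurableTypeR R) A)%E).
  rewrite [RHS]esum_mkcond; apply: eq_esum => l _.
  case: ifPn => // /negP lk; rewrite diracE memNset ?mule0// => /Ak.
  move/dyadic_cellP; have /dyadic_cellP -> := @dyadic_mem_cell R j l.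
  by move=> lkE; apply: lk; rewrite lkE; exact: mem_set.
by rewrite mule_ge0// dyadic_weight_ge0.
Qed.

Lemma integral_dyadic_product_cell j k (f : R -> \bar R) :
  measurable_fun setT f -> (forall x, 0 <= f x)%E ->
  (\int[dyadic_product P j]_(x in dyadic_cell j k) f x =
    dyadic_weight P j k * f (dyadic j k))%E.
Proof.
move=> mf f0.
have w0 : (0 <= fine (dyadic_weight P j k))%R.
  by rewrite fine_ge0// dyadic_weight_ge0.
have mD : measurable (dyadic_cell j k : set (measurableTypeR R)).
  exact: measurable_dyadic_cell.
rewrite (eq_measure_integral
  (mscale (NngNum w0) (dirac (dyadic j k : measurableTypeR R)))); last first.
  move=> A _ Ak; rewrite [LHS](dyadic_product_subcell Ak).
  by rewrite -[in LHS](fineK (dyadic_weight_fin_num P j k)).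
rewrite ge0_integral_mscale//; last exact: measurable_funTS.
rewrite integral_dirac//; last exact: measurable_funTS.
rewrite /= fineK ?dyadic_weight_fin_num// diracE mem_set ?mul1e//.
exact: dyadic_mem_cell.
Qed.

Lemma prod_cell_density j x : (\prod_i cell_density i j x)%:E =
  (((2 ^+ j) ^+ n)%:E * dyadic_weight P j (cell_index j x))%E.
Proof.
rewrite /cell_density big_split/= prodr_const card_ord EFinM; congr (_ * _)%E.
rewrite /dyadic_weight -prodEFin; apply: eq_bigr => i _; rewrite fineK//.
by apply: fin_num_measure; exact: measurable_dyadic_cell.
Qed.

(** The factor by which to multiply a Lebesgue integral of the product of the
    cell densities to get an integral against [dyadic_product P j]: it undoes
    the factor [2 ^+ j] of each of the [n] densities, and the factor
    [(2 ^+ j)^-1] that is the length of a cell. *)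
Definition cell_scale j : R := 2 ^+ j / (2 ^+ j) ^+ n.

Lemma cell_scale_gt0 j : 0 < cell_scale j.
Proof. by rewrite divr_gt0 ?exprn_gt0. Qed.

(** Integrating against [dyadic_product P j] amounts, up to a constant, to
    integrating a step function against the Lebesgue measure. *)
Lemma integral_dyadic_product j (f : R -> R) :
  measurable_fun setT f -> (forall x, 0 <= f x) ->
  (\int[dyadic_product P j]_x (f x)%:E = (cell_scale j)%:E *
    \int[lebesgue_measure]_x
      (f (dyadic j (cell_index j x)) * \prod_i cell_density i j x)%:E)%E.
Proof.
move=> mf f0.
have g0 x : (0 <= (f (dyadic j (cell_index j x)) *
    \prod_i cell_density i j x)%:E)%E.
  by rewrite lee_fin mulr_ge0// prodr_ge0// => i _; exact: cell_density_ge0.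
have mg : measurable_fun setT (fun x => (f (dyadic j (cell_index j x)) *
    \prod_i cell_density i j x)%:E).
  apply/measurable_EFinP/measurable_funM.
    exact: (measurable_fun_cell_index j (f \o dyadic j)).
  by apply: measurable_prod => i _; exact: measurable_cell_density.
rewrite (ge0_integral_dyadic_cell _ j)//; last exact/measurable_EFinP.
rewrite -ge0_integralZl//; last by rewrite lee_fin ltW// cell_scale_gt0.
rewrite (ge0_integral_dyadic_cell _ j)//; last 2 first.
  exact: measurable_funeM.
  by move=> x; rewrite mule_ge0// lee_fin ltW// cell_scale_gt0.
apply: eq_esum => k _; rewrite integral_dyadic_product_cell//; last exact/measurable_EFinP.
under eq_integral => x /set_mem/dyadic_cellP xk.
  rewrite (EFinM (f _)) prod_cell_density xk.
  over.
rewrite /= integral_cst//; last exact: measurable_dyadic_cell.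
rewrite [X in (_ = _ * X)%E](lebesgue_measure_dyadic_cell j k).
rewrite -(fineK (dyadic_weight_fin_num P j k)) -!EFinM /cell_scale; congr EFin.
by field; rewrite !expf_neq0.
Qed.

End discretization.

(** * Limit of the cell densities *)

Section cell_density_limit.
Context {R : realType} {n : nat}.
Local Notation leb := lebesgue_measure.
Variables (P : 'I_n -> probability (measurableTypeR R) R) (p : 'I_n -> R -> R).
Hypothesis p_ge0 : forall i x, 0 <= p i x.
Hypothesis p_cont : forall i, continuous (p i).
Hypothesis PE : forall i (A : set (measurableTypeR R)), measurable A ->
  P i A = (\int[leb]_(x in A) (p i x)%:E)%E.
Implicit Types (i : 'I_n) (j : nat) (x y : R).

Let mp i : measurable_fun setT (p i).
Proof. exact: continuous_measurable_fun. Qed.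

(** A cell density lies between any two bounds of the density that hold within
    one cell length of [x]. This gives both the pointwise limit and the
    domination. *)
Lemma cell_density_between i j x (a b : R) :
  (forall y, `|x - y| <= (2 ^+ j)^-1 -> a <= p i y <= b) ->
  a <= cell_density P i j x <= b.
Proof.
move=> ab; set D : set R := dyadic_cell j (cell_index j x).
have mD : measurable (D : set (measurableTypeR R)).
  exact: measurable_dyadic_cell.
have D_ab y : D y -> a <= p i y <= b.
  by move=> Dy; apply/ab/(dyadic_cell_dist (mem_dyadic_cell j x) Dy).
have intp : leb.-integrable D (EFin \o p i).
  apply/integrableP; split.
    by apply/measurable_EFinP; apply: measurable_funTS; exact: mp.
  under eq_integral => y _ do rewrite /= ger0_norm//.
  rewrite -PE// (le_lt_trans (probability_le1 _ _))//.
  exact: ltry.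
have intc c : leb.-integrable D (cst c%:E).
  apply/integrableP; split; first exact: measurable_cst.
  rewrite /= integral_cst//.
  by rewrite [X in (_ * X)%E](lebesgue_measure_dyadic_cell j _) -EFinM ltry.
have PD : (fine (P i D))%:E = (\int[leb]_(y in D) (p i y)%:E)%E.
  by rewrite -PE// fineK//; exact: fin_num_measure.
have cstD c : (\int[leb]_(y in D) (cst c%:E) y = (c / 2 ^+ j)%:E)%E.
  by rewrite integral_cst// [X in (_ * X)%E](lebesgue_measure_dyadic_cell j _).
have j0 : 0 < (2 : R) ^+ j by rewrite exprn_gt0.
have -> : cell_density P i j x = 2 ^+ j * fine (P i D) by [].
rewrite mulrC -(ler_pdivlMr _ _ j0) -(ler_pdivrMr _ _ j0).
apply/andP; split; rewrite -lee_fin -cstD.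
  rewrite [leRHS]PD.
  by apply: le_integral => // y /set_mem /D_ab /andP[].
rewrite [leLHS]PD.
by apply: le_integral => // y /set_mem /D_ab /andP[].
Qed.

Lemma cvg_dyadic_approx (x : R) : dyadic j (cell_index j x) @[j --> \oo] --> x.
Proof.
apply/cvgrPdist_le => e e0; near=> j.
apply: (le_trans (@dyadic_cell_dist R j (cell_index j x) _ _ _ _)).
- exact: mem_dyadic_cell.
- exact: dyadic_mem_cell.
rewrite -div1r; near: j.
by apply: filterS (near_infty_natSinv_expn_lt (PosNum e0)) => j /ltW.
Unshelve. all: by end_near. Qed.

Lemma cvg_cell_density i x : cell_density P i j x @[j --> \oo] --> p i x.
Proof.
apply/cvgrPdist_le => e e0.
have /cvgrPdist_le/(_ _ e0)/nbhs_ballP[d /= d0 dP] := p_cont (i:=i) (x:=x).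
near=> j; suff : p i x - e <= cell_density P i j x <= p i x + e.
  by rewrite ler_norml => /andP[? ?]; apply/andP; split; lra.
apply: cell_density_between => y xy.
have /dP : ball x d y.
  rewrite /ball/=; apply: (le_lt_trans xy); rewrite -div1r; near: j.
  exact: near_infty_natSinv_expn_lt (PosNum d0).
by rewrite ler_norml => /andP[? ?]; apply/andP; split; lra.
Unshelve. all: by end_near. Qed.

Lemma cvg_prod_cell_density x :
  \prod_i cell_density P i j x @[j --> \oo] --> \prod_i p i x.
Proof.
apply: (@cvg_big R 'I_n (fun a b : R => a * b) 1 xpredT (@mul_continuous R)
  nat \oo _ (fun i j => cell_density P i j x) (p^~ x)).
by move=> i _; exact: cvg_cell_density.
Qed.

Variables (M : 'I_n -> R) (i0 : 'I_n) (g : R -> R).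
Hypothesis p_le : forall i x, p i x <= M i.
Hypothesis g_env : forall x y, `|x - y| <= 1 -> p i0 y <= g x.

(** All factors but the one of index [i0] are bounded by constants; the latter
    is bounded by [g], because the cells have length at most 1. *)
Lemma prod_cell_density_le j x :
  \prod_i cell_density P i j x <= (\prod_(i | i != i0) M i) * g x.
Proof.
have j1 : (2 ^+ j)^-1 <= 1 :> R.
  by rewrite invf_le1 ?exprn_gt0// exprn_ege1// ler1n.
rewrite (bigD1 i0)//= mulrC ler_pM//.
- by rewrite prodr_ge0// => i _; exact: cell_density_ge0.
- exact: cell_density_ge0.
- apply: ler_prod => i _; rewrite cell_density_ge0/=.
  by have /andP[] := @cell_density_between i j x 0 (M i)
    (fun y _ => introT andP (conj (p_ge0 i y) (p_le i y))).
- suff /andP[] : 0 <= cell_density P i0 j x <= g x by [].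
  apply: cell_density_between => y xy.
  by rewrite p_ge0 g_env// (le_trans xy).
Qed.

Hypothesis int_g : leb.-integrable setT (EFin \o g).

(** Dominated convergence for the step functions of
    [integral_dyadic_product]. *)
Lemma cvg_integral_cell_density (f : R -> R) (C : R) :
  continuous f -> (forall x, `|f x| <= C) ->
  (\int[leb]_x (f (dyadic j (cell_index j x)) *
                \prod_i cell_density P i j x)%:E @[j --> \oo] -->
   \int[leb]_x (f x * \prod_i p i x)%:E)%E.
Proof.
move=> cf fC; set K := \prod_(i | i != i0) M i.
have [] // := @dominated_convergence _ _ _ leb setT measurableT
  (fun j x => (f (dyadic j (cell_index j x)) *
                \prod_i cell_density P i j x)%:E)
  (fun x => (f x * \prod_i p i x)%:E)
  (fun x => (C * K * g x)%:E).
- move=> j; apply/measurable_EFinP/measurable_funM.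
    exact: (measurable_fun_cell_index j (f \o dyadic j)).
  by apply: measurable_prod => i _; exact: measurable_cell_density.
- apply/measurable_EFinP/measurable_funM; first exact: continuous_measurable_fun.
  by apply: measurable_prod => i _; exact: mp.
- apply: aeW => x _; apply: cvg_EFin; first exact: nearW.
  apply: cvgM; last exact: cvg_prod_cell_density.
  by apply: continuous_cvg; [exact: cf|exact: cvg_dyadic_approx].
- under eq_fun do rewrite EFinM.
  exact: integrableZl.
- apply: aeW => x j _; rewrite lee_fin normrM -mulrA ler_pM//.
  rewrite ger0_norm; first exact: prod_cell_density_le.
  by rewrite prodr_ge0// => i _; exact: cell_density_ge0.
Qed.

End cell_density_limit.

(** * Vague convergence and normalization *)

Section vague.
Context {R : realType}.
Implicit Types f : R -> R.

Lemma vanishing_bounded f : continuous f -> vanishing_at_infinity f ->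
  exists C, forall x, `|f x| <= C.
Proof.
move=> cf [fy fNy].
have [a [_ fa]] : \forall x \near +oo%R, `|f x| <= 1 by exact: cvgr0_norm_le.
have [b [_ fb]] : \forall x \near -oo%R, `|f x| <= 1 by exact: cvgr0_norm_le.
have /compact_bounded[M [_ fM]] : compact (f @` `[b, a]).
  by apply: continuous_compact; [exact: continuous_subspaceT|exact: segment_compact].
exists (Num.max 1 (M + 1)) => x; rewrite le_max.
have [ax|xa] := ltP a x; first by rewrite fa.
have [xb|bx] := ltP x b; first by rewrite fb.
by rewrite (fM (M + 1)) ?orbT ?ltrDl//; exists x => //=; rewrite in_itv/= bx.
Qed.

(** Vague convergence may be tested on nonnegative bounded continuous
    functions: split a test function into its positive and negative parts, the
    integrals of which against a sub-probability measure are finite. *)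
Lemma vague_cvg_ge0 (nu_ : nat -> subprobability (measurableTypeR R) R)
    (nu : subprobability (measurableTypeR R) R) :
  (forall f C, continuous f -> (forall x, 0 <= f x <= C) ->
    (\int[nu_ j]_x (f x)%:E @[j --> \oo] --> \int[nu]_x (f x)%:E)%E) ->
  vague_cvg nu_ nu.
Proof.
move=> h f cf /(vanishing_bounded cf)[C fC].
have posE (g : R -> R) : (fun x => (g x)%:E)^\+%E = (fun x => (Num.max (g x) 0)%:E).
  by apply/funext => x; rewrite funeposE EFin_max.
have negE (g : R -> R) : (fun x => (g x)%:E)^\-%E = (fun x => (Num.max (- g x) 0)%:E).
  by apply/funext => x; rewrite funenegE -EFinN EFin_max.
have c0 : continuous (cst (0 : R) : R -> R) by move=> x; exact: cvg_cst.
have cpos : continuous (fun x => Num.max (f x) 0).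
  by move=> x; exact: (continuous_max (cf x) (c0 x)).
have cneg : continuous (fun x => Num.max (- f x) 0).
  by move=> x; exact: (continuous_max (continuousN (cf x)) (c0 x)).
have fin_nu (g : R -> R) : continuous g -> (forall x, 0 <= g x <= C) ->
    (\int[nu]_x (g x)%:E)%E \is a fin_num.
  move=> cg gC; rewrite ge0_fin_numE; last first.
    by apply: integral_ge0 => x _; rewrite lee_fin; have /andP[] := gC x.
  apply: (@le_lt_trans _ _ (\int[nu]_x (cst C%:E) x)%E).
    apply: ge0_le_integral => //.
    - by move=> x _; rewrite lee_fin; have /andP[] := gC x.
    - by apply/measurable_EFinP; exact: continuous_measurable_fun.
    - by move=> x _; rewrite lee_fin; have /andP[] := gC x.
  rewrite integral_cst//= lte_mul_pinfty ?lee_fin//.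
    by apply: (le_trans _ (fC 0)).
  by rewrite (le_lt_trans (@sprobability_setT _ _ _ nu))// ltry.
have posC x : 0 <= Num.max (f x) 0 <= C.
  rewrite le_max lexx orbT/= ge_max (le_trans (ler_norm _) (fC x))/=.
  exact: le_trans (fC x).
have negC x : 0 <= Num.max (- f x) 0 <= C.
  rewrite le_max lexx orbT/= ge_max (le_trans (ler_norm _))/= ?normrN//.
  exact: le_trans (fC x).
rewrite integralE posE negE.
under eq_fun do rewrite integralE posE negE.
apply: cvgeB; [|exact: (h _ C)|exact: (h _ C)].
by rewrite fin_num_adde_defr// fin_nu.
Qed.

End vague.

Section normalize_integral.
Local Open Scope ereal_scope.
Context d (T : measurableType d) (R : realType).
Variable m : {measure set T -> \bar R}.

Lemma ge0_integral_normalize (f : T -> \bar R) : measurable_fun setT f ->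
  (forall x, 0 <= f x) ->
  \int[normalize m]_x f x = ((fine (m setT))^-1)%:E * \int[m]_x f x.
Proof. by move=> mf f0; rewrite ge0_integral_mscale. Qed.

End normalize_integral.

(** No finiteness of [x] is required, since [fine] maps both infinities
    to 0. *)
Lemma fine_scale {R : realType} (c : R) (x : \bar R) : 0 < c ->
  fine (c%:E * x)%E = c * fine x.
Proof.
move=> c0; case: x => [r| |]; first by [].
  by rewrite mulry gtr0_sg// mul1e mulr0.
by rewrite mulrNy gtr0_sg// mul1e mulr0.
Qed.

(** * Conflation of absolutely continuous distributions *)

Section conflation_density.
Context {R : realType} {n : nat}.
Local Notation leb := lebesgue_measure.

(** Conflation of absolutely continuous distributions: if the densities [p i]
    are continuous and bounded, and the supremum of one of them over the unit
    neighbourhoods is bounded by an integrable function [g], then the conflation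
    has the normalized product of the densities as its density [q]. *)
Theorem conflation_density (P : 'I_n -> probability (measurableTypeR R) R)
    (p : 'I_n -> R -> R) (Q : probability (measurableTypeR R) R) (q : R -> R)
    (Z : R) (M : 'I_n -> R) (i0 : 'I_n) (g : R -> R) :
  (forall i x, 0 <= p i x) -> (forall i, continuous (p i)) ->
  (forall i (A : set (measurableTypeR R)), measurable A ->
    P i A = (\int[leb]_(x in A) (p i x)%:E)%E) ->
  (forall i x, p i x <= M i) ->
  (forall x y, `|x - y| <= 1 -> p i0 y <= g x) ->
  leb.-integrable setT (EFin \o g) ->
  (forall x, 0 <= q x) -> measurable_fun setT q ->
  (forall A : set (measurableTypeR R), measurable A ->
    Q A = (\int[leb]_(x in A) (q x)%:E)%E) ->
  0 < Z -> (forall x, \prod_i p i x = Z * q x) ->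
  is_conflation P Q.
Proof.
move=> p0 pcont PE pM pg gint q0 mq QE Z0 pq.
pose I (f : R -> R) j := (\int[leb]_x (f (dyadic j (cell_index j x)) *
    \prod_i cell_density P i j x)%:E)%E.
have I_cvg (f : R -> R) C : continuous f -> (forall x, 0 <= f x <= C) ->
    I f j @[j --> \oo] --> (Z%:E * \int[Q]_x (f x)%:E)%E.
  move=> cf fC.
  have f0 x : 0 <= f x by have /andP[] := fC x.
  have mf : measurable_fun setT f by exact: continuous_measurable_fun.
  rewrite (_ : (Z%:E * _)%E = (\int[leb]_x (f x * \prod_i p i x)%:E)%E).
    apply: (cvg_integral_cell_density p0 pcont PE pM pg gint cf (C := C)).
    by move=> x; have /andP[f0x fCx] := fC x; rewrite ger0_norm.
  rewrite (@ge0_integral_density _ (measurableTypeR R) R Q leb q q0 mq QE); last 2 first.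
  - exact/measurable_EFinP.
  - by move=> x; rewrite lee_fin.
  rewrite -ge0_integralZl//; last 3 first.
  - by apply: emeasurable_funM; exact/measurable_EFinP.
  - by move=> x _; rewrite mule_ge0 ?lee_fin.
  - by rewrite lee_fin ltW.
  by apply: eq_integral => x _; rewrite pq -!EFinM mulrCA.
have int1 (m : {measure set (measurableTypeR R) -> \bar R}) :
    (\int[m]_x (cst 1%R x)%:E)%E = m setT.
  by rewrite (integral_cst m measurableT 1%E) mul1e.
have I1_cvg : I (cst 1%R) j @[j --> \oo] --> Z%:E.
  have := @I_cvg (cst 1) 1 (fun x => @cvg_cst _ _ _ _ _) _.
  rewrite int1 [X in (_ * X)%E]probability_setT mule1; apply.
  by move=> x; rewrite lexx ler01.
(* The scale factor cancels between the integral of f and the total mass,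
   which is the integral of 1. *)
apply: vague_cvg_ge0 => f C cf fC.
have f0 x : 0 <= f x by have /andP[] := fC x.
have mf : measurable_fun setT f by exact: continuous_measurable_fun.
have -> : (fun j => \int[normalize (dyadic_product P j)]_x (f x)%:E)%E =
    (fun j => ((fine (I (cst 1%R) j))^-1)%:E * I f j)%E.
  apply/funext => j; rewrite ge0_integral_normalize; last 2 first.
  - exact/measurable_EFinP.
  - by move=> x; rewrite lee_fin.
  rewrite [X in fine X](_ : _ = ((@cell_scale R n j)%:E * I (cst 1%R) j)%E); last first.
    rewrite -int1.
    by apply: integral_dyadic_product => //; exact: measurable_cst.
  rewrite integral_dyadic_product// muleA -EFinM; congr (_%:E * _)%E.
  have c0 := @cell_scale_gt0 R n j.
  rewrite fine_scale//.
  by rewrite invfM mulrAC mulVf ?mul1r// gt_eqF.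
rewrite (_ : (\int[Q]_x (f x)%:E)%E =
    ((Z^-1)%:E * (Z%:E * \int[Q]_x (f x)%:E))%E); last first.
  by rewrite muleA -EFinM mulVf ?mul1e// gt_eqF.
apply: cvgeM; [|apply: cvg_EFin; first exact: nearW|exact: I_cvg cf fC].
  by rewrite mule_defE eqe invr_eq0 gt_eqF//= andbF.
apply: cvgV; first by rewrite gt_eqF.
exact: fine_cvg.
Qed.

End conflation_density.

(** * Normal distributions *)

Section normal.
Context {R : realType}.
Implicit Types m s x y : R.

Lemma normal_pdfEM m s x : s != 0 ->
  normal_pdf m s x = normal_peak s * normal_fun m s x.
Proof. by move=> s0; rewrite normal_pdfE. Qed.

(** A normal density at [y] is bounded by a multiple of the normal density with
    twice the variance at any [x] within distance 1 of [y], because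
    [(x - m) ^+ 2 <= 2 * (y - m) ^+ 2 + 2]. *)
Lemma normal_pdf_le_near m s x y : s != 0 -> `|x - y| <= 1 ->
  normal_pdf m s y <=
    normal_peak s * expR (s ^- 2 / 2) / normal_peak (s * Num.sqrt 2)
    * normal_pdf m (s * Num.sqrt 2) x.
Proof.
move=> s0 xy; have s20 : s * Num.sqrt 2 != 0 by rewrite mulf_neq0// sqrtr_eq0 -ltNge.
rewrite !normal_pdfEM// -mulrA mulKf ?gt_eqF ?normal_peak_gt0//.
rewrite -mulrA ler_wpM2l ?normal_peak_ge0// /normal_fun -expRD ler_expR.
rewrite exprMn sqr_sqrtr// -subr_ge0.
rewrite (_ : _ - _ = s ^- 2 / 4 * (2 + 2 * (y - m) ^+ 2 - (x - m) ^+ 2)).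
  rewrite mulr_ge0 ?divr_ge0 ?invr_ge0 ?sqr_ge0//.
  (* (x - m)^2 + ((x - y) - (y - m))^2 = 2 (x - y)^2 + 2 (y - m)^2 *)
  have : (x - y) ^+ 2 <= 1 by rewrite -real_normK ?num_real// expr_le1.
  by have := sqr_ge0 ((x - y) - (y - m)); nra.
by field.
Qed.

(** A product of normal densities is proportional to the normal density whose
    precision [A] is the sum of the precisions and whose mean is the average of
    the means weighted by the precisions: complete the square in the
    exponent. *)
Lemma prod_normal_pdf (n : nat) (mu s : 'I_n -> R) (n_gt0 : (0 < n)%N)
    (s_gt0 : forall i, 0 < s i) :
  let A := \sum_i s i ^- 2 in
  let B := \sum_i mu i / s i ^+ 2 in
  exists2 Z, 0 < Z & forall x, \prod_i normal_pdf (mu i) (s i) x =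
    Z * normal_pdf (B / A) (Num.sqrt A^-1) x.
Proof.
move=> A B; have A0 : 0 < A.
  rewrite /A (bigD1 (Ordinal n_gt0))//= ltr_wpDr ?invr_gt0 ?exprn_gt0//.
  by rewrite sumr_ge0// => i _; rewrite invr_ge0 sqr_ge0.
have sA0 : Num.sqrt A^-1 != 0 by rewrite gt_eqF// sqrtr_gt0 invr_gt0.
pose D := \sum_i mu i ^+ 2 / s i ^+ 2.
exists ((\prod_i normal_peak (s i)) * expR ((B ^+ 2 / A - D) / 2) /
    normal_peak (Num.sqrt A^-1)).
  rewrite divr_gt0 ?mulr_gt0 ?expR_gt0 ?normal_peak_gt0//.
  by apply: prodr_gt0 => i _; rewrite normal_peak_gt0// gt_eqF.
move=> x; rewrite [in RHS]normal_pdfEM// -[RHS]mulrA mulKf ?gt_eqF ?normal_peak_gt0//.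
under eq_bigr => i _ do rewrite normal_pdfEM ?gt_eqF//.
rewrite big_split/= -mulrA; congr (_ * _).
rewrite /normal_fun -expRD -expR_sum; congr expR.
rewrite sqr_sqrtr ?invr_ge0 1?ltW//.
transitivity (\sum_i (- x ^+ 2 / 2 * s i ^- 2 + x * (mu i / s i ^+ 2) +
    - 2^-1 * (mu i ^+ 2 / s i ^+ 2))).
  by apply: eq_bigr => i _; field; rewrite gt_eqF.
rewrite !big_split/= -!mulr_sumr -/A -/B -/D.
by field; rewrite gt_eqF.
Qed.

End normal.

Theorem theorem6p1 (R : realType) (n : nat) (mu sigma : 'I_n -> R)
    (n_gt0 : (0 < n)%N) (sigma_gt0 : forall i, 0 < sigma i ^+ 2) :
  is_conflation (fun i => normal_law (mu i) (sigma i ^+ 2))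
    (normal_law ((\sum_i mu i / sigma i ^+ 2) / (\sum_i 1 / sigma i ^+ 2))
                (1 / \sum_i sigma i ^- 2)).
Proof.
(* The standard deviation, which is the absolute value of sigma i. *)
pose s i := Num.sqrt (sigma i ^+ 2).
have s_gt0 i : 0 < s i by rewrite sqrtr_gt0.
have s_neq0 i : s i != 0 by rewrite gt_eqF.
have sE i : s i ^+ 2 = sigma i ^+ 2 by rewrite sqr_sqrtr// ltW.
have AE : \sum_i s i ^- 2 = \sum_i sigma i ^- 2.
  by apply: eq_bigr => i _; rewrite sE.
have BE : \sum_i mu i / s i ^+ 2 = \sum_i mu i / sigma i ^+ 2.
  by apply: eq_bigr => i _; rewrite sE.
have /= := prod_normal_pdf mu n_gt0 s_gt0.
rewrite AE BE; set A := \sum_i sigma i ^- 2; set B := \sum_i mu i / sigma i ^+ 2.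
move=> [Z Z_gt0 ZE].
rewrite (_ : \sum_i 1 / sigma i ^+ 2 = A); last first.
  by apply: eq_bigr => i _; rewrite div1r.
rewrite div1r /normal_law.
pose i0 := Ordinal n_gt0; pose s0 := s i0.
apply: (@conflation_density _ _ _ (fun i => normal_pdf (mu i) (s i)) _
  (normal_pdf (B / A) (Num.sqrt A^-1)) Z (fun i => normal_peak (s i)) i0
  (fun x => normal_peak s0 * expR (s0 ^- 2 / 2) /
    normal_peak (s0 * Num.sqrt 2) * normal_pdf (mu i0) (s0 * Num.sqrt 2) x)).
- by move=> i x; exact: normal_pdf_ge0.
- by move=> i; exact: continuous_normal_pdf.
- by [].
- by move=> i x; exact: normal_pdf_ub.
- by move=> x y; exact: normal_pdf_le_near.
- under [X in _.-integrable _ X]eq_fun do rewrite /= EFinM.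
  by apply: integrableZl => //; exact: integrable_normal_pdf.
- by move=> x; exact: normal_pdf_ge0.
- exact: measurable_normal_pdf.
- by [].
- exact: Z_gt0.
- exact: ZE.
Qed.
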